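(* Let $\mathcal{A}\in\mathbb{T}_{p,n}$ and suppose that $\mathcal{A}$ is nonsingular. Let $b\in\mathbb{R}^n$. Then for any $\mathcal{B}\in\mathbb{T}_{p,n}$ satisfying $\|\mathcal{B}\|_{\rm Frob}<\sqrt{\lambda(\mathcal{A})}$, it holds that $$\|x\|\leq\frac{(\sigma+\|b\|)^{\frac{1}{p-1}}}{\lambda(\mathcal{A})^{\frac{1}{2(p-1)}}-\|\mathcal{B}\|_{\rm Frob}^{\frac{1}{p-1}}},\quad\forall x\in L_\sigma,$$ where $L_\sigma:=\{x\in\mathbb{R}^n : \|F(x)\|\leq\sigma\}$ and $F(x)=\mathcal{A}x^{p-1}+\mathcal{B}|x|^{p-1}-b$.
   Context: Here $p\ge 2$ and $\sigma\ge 0$. $\mathbb{T}_{m,n}$ is the set of real $m$-th order $n$-dimensional square tensors $\mathcal{A}=(a_{i_1i_2\ldots i_m})$, with $a_{i_1\ldots i_m}\in\mathbb{R}$, $1\le i_1,\ldots,i_m\le n$. For $\mathcal{A}\in\mathbb{T}_{m,n}$ and $x\in\mathbb{R}^n$, $\mathcal{A}x^{m-1}\in\mathbb{R}^n$ is the vector with components $(\mathcal{A}x^{m-1})_i=\sum_{i_2,\ldots,i_m=1}^n a_{ii_2\ldots i_m}x_{i_2}\cdots x_{i_m}$. The vector $|x|$ is the componentwise absolute value of $x$, and $\mathcal{B}|x|^{p-1}$ denotes $\mathcal{B}y^{p-1}$ with $y=|x|$. $\|x\|$ is the Euclidean norm, and $\|\mathcal{B}\|_{\rm Frob}=\big(\sum_{i_1,\ldots,i_p=1}^n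 b_{i_1\ldots i_p}^2\big)^{1/2}$. $\mathcal{A}\in\mathbb{T}_{p,n}$ is nonsingular if there is no $x\in\mathbb{R}^n\setminus\{\mathbf{0}\}$ with $\mathcal{A}x^{p-1}=\mathbf{0}$. $\lambda(\mathcal{A})$ is the optimal value of the problem of minimizing $\|\mathcal{A}x^{p-1}\|^2$ subject to $\|x\|=1$, $x\in\mathbb{R}^n$. *)

(* Defs.v *)
From mathcomp Require Import all_boot all_order all_algebra.
From mathcomp Require Import all_classical all_reals all_analysis.

Set Implicit Arguments.
Unset Strict Implicit.
Unset Printing Implicit Defensive.

Import Order.TTheory GRing.Theory Num.Theory.

Local Open Scope classical_set_scope.
Local Open Scope ring_scope.

(* The entry a_{i_1 ... i_m} is the value at the tuple of indices
   (i_1, ..., i_m). *)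
Definition tensor (R : realType) (m n : nat) : Type :=
  {ffun m.-tuple 'I_n -> R}.

(* The vector A x^{m-1}, for m >= 1.  Its i-th component sums over the index
   tuples t = (i_1, ..., i_m) with i_1 = i; [behead t] is (i_2, ..., i_m). *)
Definition tensor_app (R : realType) (m n : nat)
    (A : tensor R m n) (x : 'cV[R]_n) : 'cV[R]_n :=
  \col_(i < n) \sum_(t : m.-tuple 'I_n | ohead t == Some i)
                  A t * \prod_(j <- behead t) x j 0.

(* The library norm on matrices is the sup norm. *)
Definition enorm (R : realType) (n : nat) (x : 'cV[R]_n) : R :=
  Num.sqrt (\sum_(i < n) x i 0 ^+ 2).

Definition absv (R : realType) (n : nat) (x : 'cV[R]_n) : 'cV[R]_n :=
  map_mx Num.norm x.

Definition frob_norm (R : realType) (m n : nat) (B : tensor R m n) : R :=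
  Num.sqrt (\sum_(t : m.-tuple 'I_n) B t ^+ 2).

Definition nonsingular (R : realType) (m n : nat) (A : tensor R m n) : Prop :=
  ~ exists x : 'cV[R]_n, x != 0 /\ tensor_app A x = 0.

Definition lambda (R : realType) (m n : nat) (A : tensor R m n) : R :=
  inf [set enorm (tensor_app A x) ^+ 2 | x in [set x : 'cV[R]_n | enorm x = 1]].

Definition residual (R : realType) (p n : nat) (A B : tensor R p n)
    (b x : 'cV[R]_n) : 'cV[R]_n :=
  tensor_app A x + tensor_app B (absv x) - b.

Definition level_set (R : realType) (p n : nat) (A B : tensor R p n)
    (b : 'cV[R]_n) (sigma : R) : set 'cV[R]_n :=
  [set x | enorm (residual A B b x) <= sigma].

(* Main.v *)
Require Import Defs.
From mathcomp Require Import all_boot all_order all_algebra.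
From mathcomp Require Import all_classical all_reals all_analysis.
From mathcomp Require Import ring lra.

(** Write q = p - 1, so that x |-> A x^q is homogeneous of degree q.  Two
    estimates control the residual from opposite sides.

    - Scaling x to the unit sphere in the definition of lambda gives
      sqrt (lambda A) * |x|^q <= |A x^q| ([lambda_le_tensor_app]).
    - Cauchy-Schwarz in each component gives |B y^q| <= |B|_Frob * |y|^q
      ([enorm_tensor_app_le]), because the squares of all degree-q monomials
      in y sum to (sum_j y_j^2)^q ([sum_tuple_prod]); and y = |x| has the same
      Euclidean norm as x.

    The triangle inequality applied to A x^q = F(x) + b - B |x|^q therefore
    yields (sqrt (lambda A) - |B|_Frob) * |x|^q <= sigma + |b|.  With u and v
    the q-th roots of sqrt (lambda A) and |B|_Frob, superadditivity of the q-th
    power ([exprD_superadd]) gives (u - v)^q <= u^q - v^q, hence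
    ((u - v) |x|)^q <= sigma + |b|, and taking q-th roots finishes the proof.

    Well-definedness of the quotient comes from the strict inequality
    |B|_Frob < sqrt (lambda A): it forces lambda A > 0 and v < u. *)

Import Order.TTheory GRing.Theory Num.Theory.

Local Open Scope classical_set_scope.
Local Open Scope ring_scope.

(** * Elementary inequalities *)

Lemma exprD_superadd (R : realDomainType) (q : nat) (a b : R) :
  0 <= a -> 0 <= b -> a ^+ q.+1 + b ^+ q.+1 <= (a + b) ^+ q.+1.
Proof.
move=> a0 b0; elim: q => [//|q IH].
rewrite !(exprS _ q.+1); apply: le_trans (ler_wpM2l (addr_ge0 a0 b0) IH).
have := mulr_ge0 a0 (exprn_ge0 q.+1 b0).
have := mulr_ge0 b0 (exprn_ge0 q.+1 a0).
by rewrite mulrDl !mulrDr; lra.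
Qed.

(** Lagrange's argument: the square of each 2 x 2 minor a_i b_j - a_j b_i is
    nonnegative, and summing over all (i, j) gives twice the claim. *)
Lemma cauchy_schwarz_sum (R : realDomainType) (I : finType) (a b : I -> R) :
  (\sum_i a i * b i) ^+ 2 <= (\sum_i a i ^+ 2) * (\sum_i b i ^+ 2).
Proof.
rewrite -(@ler_pMn2r _ 2)// !mulr2n expr2.
rewrite {2}[(\sum_i a i ^+ 2) * _]mulrC !big_distrlr -!big_split/=.
apply: ler_sum => i _; rewrite -!big_split/=; apply: ler_sum => j _.
have := sqr_ge0 (a i * b j - a j * b i).
by rewrite -subr_ge0; congr (0 <= _); ring.
Qed.

(** * The Euclidean norm *)

Lemma enorm_ge0 (R : realType) (n : nat) (x : 'cV[R]_n) : 0 <= enorm x.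
Proof. exact: sqrtr_ge0. Qed.

Lemma enorm_sqr (R : realType) (n : nat) (x : 'cV[R]_n) :
  enorm x ^+ 2 = \sum_(i < n) x i 0 ^+ 2.
Proof. by rewrite sqr_sqrtr// sumr_ge0// => i _; apply: sqr_ge0. Qed.

Lemma enormZ (R : realType) (n : nat) (k : R) (x : 'cV[R]_n) :
  enorm (k *: x) = `|k| * enorm x.
Proof.
rewrite /enorm -sqrtr_sqr -sqrtrM ?sqr_ge0// mulr_sumr.
by congr Num.sqrt; apply: eq_bigr => i _; rewrite mxE exprMn.
Qed.

Lemma enormN (R : realType) (n : nat) (x : 'cV[R]_n) : enorm (- x) = enorm x.
Proof. by rewrite -scaleN1r enormZ normrN1 mul1r. Qed.

Lemma enorm_absv (R : realType) (n : nat) (x : 'cV[R]_n) :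
  enorm (absv x) = enorm x.
Proof.
rewrite /enorm; congr Num.sqrt; apply: eq_bigr => i _.
by rewrite mxE real_normK ?num_real.
Qed.

Lemma enormD (R : realType) (n : nat) (x y : 'cV[R]_n) :
  enorm (x + y) <= enorm x + enorm y.
Proof.
rewrite -(@ler_pXn2r _ 2) ?nnegrE ?addr_ge0 ?enorm_ge0//.
have cs : \sum_(i < n) x i 0 * y i 0 <= enorm x * enorm y.
  apply: le_trans (ler_norm _) _.
  rewrite -(@ler_pXn2r _ 2) ?nnegrE ?mulr_ge0 ?enorm_ge0//.
  by rewrite real_normK ?num_real// exprMn !enorm_sqr cauchy_schwarz_sum.
rewrite sqrrD !enorm_sqr.
have -> : \sum_(i < n) (x + y) i 0 ^+ 2 =
    \sum_(i < n) x i 0 ^+ 2 + (\sum_(i < n) x i 0 * y i 0) *+ 2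
    + \sum_(i < n) y i 0 ^+ 2.
  by rewrite -sumrMnl -!big_split/=; apply: eq_bigr => i _; rewrite mxE sqrrD.
by rewrite lerD2r lerD2l ler_pMn2r.
Qed.

(** * Sums over index tuples *)

Lemma sum_tuple_head (V : nmodType) (T : finType) (q : nat)
    (F : q.+1.-tuple T -> V) (i : T) :
  \sum_(t : q.+1.-tuple T | ohead t == Some i) F t =
  \sum_(s : q.-tuple T) F (cons_tuple i s).
Proof.
rewrite (reindex_onto (cons_tuple i) (@behead_tuple _ _))/=.
  apply: eq_bigl => s; rewrite eqxx/=.
  by apply/eqP/val_inj.
by move=> t; case/tupleP: t => j s /= /eqP[->]; apply: val_inj.
Qed.

Lemma sum_tuple_cons (V : nmodType) (T : finType) (q : nat)
    (F : q.+1.-tuple T -> V) :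
  \sum_(t : q.+1.-tuple T) F t = \sum_i \sum_(s : q.-tuple T) F (cons_tuple i s).
Proof.
rewrite (partition_big (@thead _ _) predT)//=; apply: eq_bigr => i _.
rewrite -sum_tuple_head; apply: eq_bigl => t.
by case/tupleP: t => j s /=; rewrite theadE.
Qed.

(** The fully expanded form of the q-th power of a sum. *)
Lemma sum_tuple_prod (R : comNzRingType) (T : finType) (q : nat) (f : T -> R) :
  \sum_(s : q.-tuple T) \prod_(j <- s) f j = (\sum_j f j) ^+ q.
Proof.
elim: q => [|q IH].
  rewrite (big_pred1 [tuple]) ?big_nil// => s; exact/esym/eqP/tuple0.
rewrite sum_tuple_cons exprS mulr_suml; apply: eq_bigr => i _.
by rewrite -IH mulr_sumr; apply: eq_bigr => s _; rewrite big_cons.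
Qed.

(** * The map x |-> A x^q *)

Lemma tensor_appE (R : realType) (q n : nat) (A : tensor R q.+1 n)
    (x : 'cV[R]_n) (i : 'I_n) :
  tensor_app A x i 0 =
  \sum_(s : q.-tuple 'I_n) A (cons_tuple i s) * \prod_(j <- s) x j 0.
Proof. by rewrite mxE sum_tuple_head. Qed.

Lemma tensor_appZ (R : realType) (q n : nat) (A : tensor R q.+1 n)
    (k : R) (x : 'cV[R]_n) :
  tensor_app A (k *: x) = k ^+ q *: tensor_app A x.
Proof.
apply/colP => i; rewrite [RHS]mxE !tensor_appE mulr_sumr; apply: eq_bigr => s _.
rewrite mulrCA; congr (_ * _).
under eq_bigr do rewrite mxE.
by rewrite big_split/= big_const_seq count_predT size_tuple iter_mulr_1.
Qed.

(** Each component is the inner product of a slice of B with the vector of all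
    degree-q monomials in y; the squared slices add up to the squared Frobenius
    norm, and the squared monomials to |y|^(2q). *)
Lemma enorm_tensor_app_le (R : realType) (q n : nat) (B : tensor R q.+1 n)
    (y : 'cV[R]_n) :
  enorm (tensor_app B y) <= frob_norm B * enorm y ^+ q.
Proof.
have B0 : 0 <= frob_norm B by apply: sqrtr_ge0.
rewrite -(@ler_pXn2r _ 2) ?nnegrE ?mulr_ge0 ?exprn_ge0 ?enorm_ge0//.
rewrite exprMn exprAC !enorm_sqr sqr_sqrtr; last first.
  by apply: sumr_ge0 => t _; apply: sqr_ge0.
rewrite sum_tuple_cons mulr_suml; apply: ler_sum => i _.
rewrite tensor_appE; apply: le_trans (cauchy_schwarz_sum _ _ _ _) _.
rewrite ler_wpM2l ?sumr_ge0//; first by move=> s _; apply: sqr_ge0.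
rewrite -sum_tuple_prod le_eqVlt; apply/orP; left; apply/eqP.
by apply: eq_bigr => s _; rewrite prodrXl.
Qed.

(** By homogeneity it is enough to evaluate at the unit vector x / |x|, which is
    a competitor in the infimum defining lambda. *)
Lemma lambda_le_tensor_app (R : realType) (q n : nat) (A : tensor R q.+1 n)
    (x : 'cV[R]_n) : x != 0 ->
  Num.sqrt (lambda A) * enorm x ^+ q <= enorm (tensor_app A x).
Proof.
move=> x0.
have nx0 : enorm x != 0.
  apply: contra x0 => /eqP nx; apply/eqP/colP => i; rewrite mxE; apply/eqP.
  have := enorm_sqr _ _ x; rewrite nx expr0n/= => /esym/eqP.
  rewrite psumr_eq0; last by move=> j _; apply: sqr_ge0.
  by move=> /allP/(_ i (mem_index_enum i)); rewrite /= sqrf_eq0.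
set u := (enorm x)^-1 *: x.
have nu : enorm u = 1.
  by rewrite enormZ ger0_norm ?invr_ge0 ?enorm_ge0// mulVf.
have lu : lambda A <= enorm (tensor_app A u) ^+ 2.
  apply: ge_inf; last by exists u.
  by exists 0 => _ [v _ <-]; apply: sqr_ge0.
have su : Num.sqrt (lambda A) <= enorm (tensor_app A u).
  by rewrite -[leRHS]ger0_norm ?enorm_ge0// -sqrtr_sqr ler_wsqrtr.
have xu : x = enorm x *: u by rewrite scalerA mulfV// scale1r.
rewrite {2}xu tensor_appZ enormZ ger0_norm ?exprn_ge0 ?enorm_ge0// mulrC.
by rewrite ler_wpM2l// exprn_ge0// enorm_ge0.
Qed.

(** * The error bound *)

Theorem theorem4p1 (R : realType) (p n : nat) (hp : (2 <= p)%N)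
    (sigma : R) (hsigma : 0 <= sigma)
    (A : tensor R p n) (hA : nonsingular A) (b : 'cV[R]_n)
    (B : tensor R p n) (hB : frob_norm B < Num.sqrt (lambda A)) :
  forall x : 'cV[R]_n, level_set A B b sigma x ->
    enorm x <=
      (sigma + enorm b) `^ (1 / (p%:R - 1)) /
      (lambda A `^ (1 / (2 * (p%:R - 1))) - frob_norm B `^ (1 / (p%:R - 1))).
Proof.
move=> x Lx; case: p hp A hA B hB Lx => [//|q] /= q0 A _ B hB Lx.
rewrite ltnS in q0.
have -> : q.+1%:R - 1 = q%:R :> R by rewrite -natr1 addrK.
have q0R : q%:R != 0 :> R by rewrite pnatr_eq0 -lt0n.
have B0 : 0 <= frob_norm B by apply: sqrtr_ge0.
have l0 : 0 < lambda A by rewrite -sqrtr_gt0 (le_lt_trans B0).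
have c0 : 0 <= sigma + enorm b by rewrite addr_ge0 ?enorm_ge0.
have -> : lambda A `^ (1 / (2 * q%:R)) = Num.sqrt (lambda A) `^ (1 / q%:R).
  by rewrite -powR12_sqrt ?ltW// -powRrM; congr (_ `^ _); field.
have rootK (a : R) : 0 <= a -> (a `^ (1 / q%:R)) ^+ q = a.
  by move=> a0; rewrite -powR_mulrn ?powR_ge0// -powRrM divfK// powRr1.
set u := Num.sqrt (lambda A) `^ _; set v := frob_norm B `^ _.
set r := (_ + _) `^ _.
have uq : u ^+ q = Num.sqrt (lambda A) by rewrite rootK// sqrtr_ge0.
have vq : v ^+ q = frob_norm B by rewrite rootK.
have rq : r ^+ q = sigma + enorm b by rewrite rootK.
have [u0 v0 r0] : [/\ 0 <= u, 0 <= v & 0 <= r] by split; apply: powR_ge0.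
have uv : v < u by rewrite -(@ltr_pXn2r _ q) ?nnegrE// uq vq.
have uv0 : 0 < u - v by rewrite subr_gt0.
rewrite ler_pdivlMr//.
have [x0|x0] := eqVneq x 0.
  by rewrite x0 -(scale0r (0 : 'cV[R]_n)) enormZ normr0 !mul0r.
rewrite -(@ler_pXn2r _ q) ?nnegrE ?mulr_ge0 ?enorm_ge0 ?(ltW uv0)// rq exprMn.
have Ax : enorm (tensor_app A x) <=
    sigma + enorm b + frob_norm B * enorm x ^+ q.
  have -> : tensor_app A x = residual A B b x + b - tensor_app B (absv x).
    by rewrite /residual subrK addrK.
  apply: le_trans (enormD _ _ _ _) _; rewrite enormN lerD//.
    by apply: le_trans (enormD _ _ _ _) _; rewrite lerD2r.
  by rewrite -(enorm_absv _ _ x) enorm_tensor_app_le.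
have uvq : (u - v) ^+ q <= Num.sqrt (lambda A) - frob_norm B.
  rewrite -uq -vq lerBrDr -(prednK q0).
  by apply: le_trans (exprD_superadd _ _ _ _ _ _) _; rewrite ?subrK// ltW.
apply: le_trans (ler_wpM2l (exprn_ge0 q (enorm_ge0 _ _ x)) uvq) _.
by rewrite mulrC mulrBl lerBlDr (le_trans (@lambda_le_tensor_app _ _ _ A x x0)).
Qed.
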